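(* Let $\Omega\subset\mathbb{R}^n$ ($n\ge2$) be a bounded domain with smooth boundary $\Gamma=\partial\Omega$, let $\gamma\subset\Gamma$, and let $\rho\in C^2(\Gamma)$ be a positive function (the coating thickness function). As $p\to1^+$, the effective Robin coefficient $$h_p(\xi)=\frac{1}{\rho(\xi)^{p-1}}$$ converges to $1$ uniformly for $\xi\in\gamma$, independently of the thickness function $\rho>0$.
   Context: For $p>1$, the effective Robin coefficient associated with a coating of thickness $\varepsilon\rho(\xi)$ is by definition $h_p(\xi):=\rho(\xi)^{-(p-1)}$. ''Independently of $\rho$'' means that the limit is the constant $1$ for every positive $\rho\in C^2(\Gamma)$. *)

(* Defs.v *)
From HB Require Import structures.
From mathcomp Require Import all_boot all_order all_algebra.
From mathcomp Require Import all_classical all_reals all_analysis.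

Set Implicit Arguments.
Unset Strict Implicit.
Unset Printing Implicit Defensive.

Import Order.TTheory GRing.Theory Num.Theory.
Import numFieldNormedType.Exports.

Local Open Scope classical_set_scope.
Local Open Scope ring_scope.

(* R^n is 'rV[R]_n. Its library norm is the sup norm, which yields the same
   open, closed and bounded sets as the Euclidean norm. *)

Definition boundary (T : topologicalType) (A : set T) : set T :=
  closure A `\` interior A.

Definition bounded_domain (R : realType) (n : nat) (Omega : set 'rV[R]_n) :
    Prop :=
  [/\ Omega !=set0, open Omega, connected Omega & bounded_set Omega].

Definition partial (R : realType) (n : nat) (i : 'I_n) (f : 'rV[R]_n -> R) :
    'rV[R]_n -> R :=
  fun x => 'D_(delta_mx 0 i) f x.

(* Meaningful for U open: all partial derivatives of order at most k exist and
   are continuous at every point of U. *)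
Fixpoint Ck_on (R : realType) (n k : nat) (U : set 'rV[R]_n)
    (f : 'rV[R]_n -> R) : Prop :=
  (forall x, U x -> {for x, continuous f}) /\
  match k with
  | 0 => True
  | k'.+1 => forall i : 'I_n,
      (forall x, U x -> derivable f x (delta_mx 0 i)) /\
      Ck_on k' U (partial i f)
  end.

Definition smooth_on (R : realType) (n : nat) (U : set 'rV[R]_n)
    (f : 'rV[R]_n -> R) : Prop :=
  forall k : nat, Ck_on k U f.

(* Near each boundary point, Omega is the sublevel set {phi < 0} of a smooth
   function phi with nonvanishing gradient; for Omega open this forces
   boundary Omega = {phi = 0} there, and Omega lies locally on one side. *)
Definition smooth_boundary (R : realType) (n : nat) (Omega : set 'rV[R]_n) :
    Prop :=
  forall x, boundary Omega x ->
    exists (U : set 'rV[R]_n) (phi : 'rV[R]_n -> R),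
      [/\ open U, U x, smooth_on U phi,
          forall y, U y -> exists i : 'I_n, partial i phi y != 0
        & Omega `&` U = [set y | phi y < 0] `&` U].

(* f is of class C^k on the hypersurface S: near each of its points, f agrees
   on S with a C^k function of the ambient space. Only the values of f on S
   matter. *)
Definition Ck_hypersurface (R : realType) (n k : nat) (S : set 'rV[R]_n)
    (f : 'rV[R]_n -> R) : Prop :=
  forall x, S x ->
    exists (U : set 'rV[R]_n) (F : 'rV[R]_n -> R),
      [/\ open U, U x, Ck_on k U F & forall y, S y -> U y -> F y = f y].

Definition robin_coeff (R : realType) (n : nat) (rho : 'rV[R]_n -> R) (p : R) :
    'rV[R]_n -> R :=
  fun xi => 1 / (rho xi `^ (p - 1)).

(* Main.v *)
(* On the compact hypersurface [boundary Omega] the function [ln rho] is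
   continuous, hence bounded by some M, so the exponent in
   [h_p = expR (- (p - 1) * ln rho)] tends to 0 uniformly as [p] tends to 1. *)
Require Import Defs.
From HB Require Import structures.
From mathcomp Require Import all_boot all_order all_algebra.
From mathcomp Require Import all_classical all_reals all_analysis.

Import Order.TTheory GRing.Theory Num.Theory.
Import numFieldNormedType.Exports.

Local Open Scope classical_set_scope.
Local Open Scope ring_scope.

(** A closed ball around 0 that contains [A] is a closed set, so it contains [closure A] too. *)
Lemma bounded_set_closure (R : realType) (V : normedModType R) (A : set V) :
  bounded_set A -> bounded_set (closure A).
Proof.
move=> [M [Mreal AM]]; exists M; split=> // x Mx.
have -> : [set y : V | `|y| <= x] = closure [set y : V | `|y| <= x].
  apply/closure_id.
  by apply: (closed_comp _ (@closed_le R x)) => y _; exact: norm_continuous.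
exact/closure_subset/AM.
Qed.

Lemma compact_boundary (R : realType) (n : nat) (A : set 'rV[R]_n) :
  bounded_set A -> compact (boundary A).
Proof.
move=> bA; apply: bounded_closed_compact.
  have [M [Mreal AM]] := bounded_set_closure _ _ _ bA.
  by exists M; split=> // x Mx y [cy _]; exact: (AM x Mx).
rewrite /boundary setDE; apply: closedI; first exact: closed_closure.
exact/open_closedC/open_interior.
Qed.

(** Near a point of [S], the local extension [F] is continuous in the ambient space, and [f]
    coincides with it on [S]. *)
Lemma Ck_hypersurface_continuous (R : realType) (n k : nat)
    (S : set 'rV[R]_n) (f : 'rV[R]_n -> R) :
  Ck_hypersurface k S f -> {within S, continuous f}.
Proof.
move=> Ckf; apply/subspace_continuousP => x Sx.
have [U [F [oU Ux CkF Ff]]] := Ckf x Sx.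
have Fx : F y @[y --> within S (nbhs x)] --> f x.
  apply: cvg_within_filter; rewrite -Ff//.
  (* Continuity is the first component of [Ck_on] at every order; the case split only lets the
     fixpoint unfold. *)
  by case: k CkF {Ckf} => [|k] [cF _]; exact: cF.
apply: cvg_trans Fx; apply: near_eq_cvg.
rewrite near_withinE; near=> y => Sy; apply: Ff => //.
by near: y; exact: open_nbhs_nbhs.
Unshelve. all: by end_near. Qed.

Lemma bounded_ln_compact (R : realType) (T : topologicalType) (K : set T)
    (f : T -> R) :
  compact K -> {within K, continuous f} -> (forall x, K x -> 0 < f x) ->
  exists2 M, 0 < M & forall x, K x -> `|ln (f x)| <= M.
Proof.
move=> cK cf f0.
have clnf : {within K, continuous (fun x => ln (f x))}.
  apply/subspace_continuousP => x Kx.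
  apply: (cvg_comp f (@ln R)); first exact: (subspace_continuousP _ _).1 cf x Kx.
  exact/continuous_ln/f0.
have [M [Mreal KM]] := compact_bounded (continuous_compact clnf cK).
(* Boundedness holds for every radius strictly above [M], whose sign is unknown; this one is also
   positive, so that it can serve as a divisor. *)
exists (`|M| + 1) => [|x Kx]; first by rewrite ltr_wpDl.
apply: (KM (`|M| + 1)); last by exists x.
by rewrite (le_lt_trans (ler_norm M))// ltrDl.
Qed.

(** Positivity of [rho xi] excludes the separate branch of [powR] at base 0. *)
Lemma robin_coeffE (R : realType) (n : nat) (rho : 'rV[R]_n -> R) (p : R)
    (xi : 'rV[R]_n) :
  0 < rho xi -> robin_coeff rho p xi = expR (- ((p - 1) * ln (rho xi))).
Proof. by move=> r0; rewrite /robin_coeff div1r expRN /powR gt_eqF. Qed.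

Theorem proposition3p12 (R : realType) (n : nat) (hn : (2 <= n)%N)
    (Omega : set 'rV[R]_n) (hOmega : bounded_domain Omega)
    (hsmooth : smooth_boundary Omega)
    (gamma : set 'rV[R]_n) (hgamma : gamma `<=` boundary Omega)
    (rho : 'rV[R]_n -> R) (hrho : Ck_hypersurface 2 (boundary Omega) rho)
    (rho_gt0 : forall xi, boundary Omega xi -> 0 < rho xi) :
  {uniform gamma, (fun p : R => robin_coeff rho p) @ 1^'+ --> (fun=> 1 : R)}.
Proof.
have [_ _ _ bOmega] := hOmega.
have [M M0 lnM] := bounded_ln_compact _ _ _ _ (compact_boundary _ _ _ bOmega)
  (Ck_hypersurface_continuous _ _ _ _ _ hrho) rho_gt0.
(* It suffices to be [E]-close to 1 at all points of [gamma] at once, and [E] contains a uniform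
   [e]-ball relation. *)
move=> P /uniform_nbhs[E [entE EP]].
have [e /= e0 eE] : exists2 e : R, 0 < e &
    [set xy : R * R | ball xy.1 e xy.2] `<=` E.
  by move: entE; rewrite -entourage_from_ballE.
have [d /= d0 dexp] : nbhs_ball (0 : R) (expR @^-1` ball (expR 0) e).
  by apply/nbhs_ballP/continuous_expR; exact: nbhsx_ballx.
(* The bound [d / M] makes [(p - 1) * M < d], with no dependence on [xi]: this is the uniformity. *)
have near1 : \forall p \near (1 : R)^'+, 1 < p < 1 + d / M.
  near=> p; apply/andP; split; near: p; first exact: nbhs_right_gt.
  by apply: nbhs_right_lt; rewrite ltrDl divr_gt0.
apply: filterS near1 => p /andP[p1 pd].
apply: EP => xi gxi; apply: eE => /=.
rewrite robin_coeffE; last exact/rho_gt0/hgamma.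
(* With 1 read as [expR 0], only the exponent has to be within [d] of 0. *)
rewrite -[X in ball X]expR0; apply: dexp.
rewrite /ball /= sub0r opprK normrM gtr0_norm ?subr_gt0//.
apply: (@le_lt_trans _ _ ((p - 1) * M)).
  by rewrite ler_wpM2l ?subr_ge0 ?(ltW p1)//; exact/lnM/hgamma.
by rewrite -ltr_pdivlMr// ltrBlDl.
Unshelve. all: by end_near. Qed.
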